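(* Let $G$ be a graph, let $x\in V(G)$, and let $\ell\ge1$ and $i\ge0$ be integers. If $\mathrm{gir}_x(G)\ge 2i+5$, then $$\mathrm{MH}^{x}_{\ell-j,\ell}(G)\cong\begin{cases}\mathbb{Z}^{\deg x}, & j=0,\\ 0, & 1\le j\le i.\end{cases}$$
   Context: A graph means a finite simple undirected graph without loops, with nonempty vertex set $V(G)$ and edge set $E(G)$ (not necessarily connected); $\deg x$ is the number of vertices adjacent to $x$. An $i$-cycle ($i\ge 3$) in $G$ is a tuple $(x_0,\dots,x_i)$ of vertices with $\{x_k,x_{k+1}\}\in E(G)$ for $0\le k\le i-1$, $x_0=x_i$, and $x_0,\dots,x_{i-1}$ all distinct. The local girth at a vertex $x$ is $\mathrm{gir}_x(G)=\inf\{i\ge3 \mid \text{there is an } i\text{-cycle in } G \text{ containing } x\}$, with $\inf\emptyset=\infty$. Let $d(x,y)$ be the length of a shortest path between $x$ and $y$ ($\infty$ if there is none), and $L(x_0,\dots,x_k)=\sum_{i=1}^k d(x_{i-1},x_i)$. For integers $k,\ell\ge 0$, $\mathrm{MC}_{k,\ell}(G)$ is the free $\mathbb{Z}$-module generated by the tuples $(x_0,\dots,x_k)\in V(G)^{k+1}$ with $x_{i-1}\ne x_i$ for all $1\le i\le k$ and $L(x_0,\dots,x_k)=\ell$; $\mathrm{MC}_{k,\ell}(G)=0$ for $k<0$. The boundary map $\partial_{k,\ell}:\mathrm{MC}_{k,\ell}(G)\to\mathrm{MC}_{k-1,\ell}(G)$ is given for $k\ge1$ by $\partial_{k,\ell}(x_0,\dots,x_k)=\sum_{i}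 (-1)^i (x_0,\dots,\hat{x}_i,\dots,x_k)$, the sum over those $1\le i\le k-1$ with $d(x_{i-1},x_{i+1})=d(x_{i-1},x_i)+d(x_i,x_{i+1})$ (the hat means deletion), and $\partial_{0,\ell}=0$. The submodule $\mathrm{MC}^x_{k,\ell}(G)$ generated by those tuples with $x_0=x$ is a subcomplex, and the localized magnitude homology is $\mathrm{MH}^x_{k,\ell}(G)=\ker(\partial_{k,\ell}|_{\mathrm{MC}^x_{k,\ell}(G)})/\partial_{k+1,\ell}(\mathrm{MC}^x_{k+1,\ell}(G))$ (so it is $0$ for $k<0$). *)

(* Defs.v *)
From HB Require Import structures.
From mathcomp Require Import all_boot all_order all_algebra.
From mathcomp Require Import generic_quotient ring_quotient.
From mathcomp Require Import finmap.
From mathcomp Require Import monalg.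
From mathcomp Require Import boolp.

Set Implicit Arguments.
Unset Strict Implicit.
Unset Printing Implicit Defensive.

Import GRing.Theory Num.Theory.
Local Open Scope ring_scope.

(* Extended natural numbers: [None] stands for infinity. *)
Definition inf_nat (P : pred nat) : option nat :=
  if pselect (exists n, P n) is left h then Some (ex_minn h) else None.

Definition add_enat (m n : option nat) : option nat :=
  if (m, n) is (Some a, Some b) then Some (a + b)%N else None.

Definition leq_enat (m : nat) (n : option nat) : bool :=
  if n is Some b then (m <= b)%N else true.

(* A finite simple graph is a finType V with a symmetric irreflexive relation
   e; the definitions below make sense for any relation. *)
Section Graph.
Context (V : finType) (e : rel V).
Implicit Types (x y : V) (s : seq V) (l : nat) (k : int).

Definition deg x : nat := #|[set y | e x y]|.

(* The i-cycle (x_0, ..., x_i), x_i = x_0, is encoded by (x_0, ..., x_{i-1}). *)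
Definition local_girth x : option nat :=
  inf_nat (fun i => (3 <= i)%N &&
    [exists c : i.-tuple V, [&& cycle e c, uniq c & x \in c]]).

Definition dist x y : option nat :=
  inf_nat (fun n => [exists p : n.-tuple V, path e x p && (last x p == y)]).

Definition len s : option nat :=
  if s is x :: p then foldr add_enat (Some 0%N) (pairmap dist x p)
  else Some 0%N.

Definition mc_gen k l s : bool :=
  [&& s != [::], (size s)%:Z == k + 1, sorted (fun x y => x != y) s
    & len s == Some l].

Definition mcx_gen x k l s : bool := mc_gen k l s && (ohead s == Some x).

(* The free Z-module on all sequences; each MC_{k,l} is the submodule
   generated by the sequences satisfying [mc_gen k l]. *)
Definition chain := {malg int[seq V]}.

Definition del (i : nat) s : seq V := take i s ++ drop i.+1 s.

Definition smooth (i : nat) s : bool :=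
  if drop i.-1 s is [:: a, b, c & _]
  then dist a c == add_enat (dist a b) (dist b c) else false.

(* A generator (x_0, ..., x_k) has size k.+1, so the index i ranges over
   1 <= i <= k - 1. *)
Definition bnd_gen s : chain :=
  \sum_(1 <= i < (size s).-1 | smooth i s) (-1) ^+ i *: << del i s >>.

Definition bnd (c : chain) : chain :=
  \sum_(s <- msupp c) c@_s *: bnd_gen s.

Lemma bnd_wide (d : {fset seq V}) (c : chain) :
  (msupp c `<=` d)%fset -> bnd c = \sum_(s <- d) c@_s *: bnd_gen s.
Proof.
move=> le; rewrite /bnd (big_fset_incl _ le) // => s _ /mcoeff_outdom ->.
by rewrite scale0r.
Qed.

Lemma bnd_is_zmod_morphism : zmod_morphism bnd.
Proof.
move=> c1 c2; pose d := (msupp c1 `|` msupp c2)%fset.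
rewrite (@bnd_wide d (c1 - c2)) ?msuppB_le // (@bnd_wide d c1) ?fsubsetUl //.
rewrite (@bnd_wide d c2) ?fsubsetUr // -sumrB.
by apply: eq_bigr => s _; rewrite mcoeffB scalerBl.
Qed.
HB.instance Definition _ := GRing.isZmodMorphism.Build chain chain bnd
  bnd_is_zmod_morphism.

(* MC^x_{k,l}; it is zero for k < 0 since generators are nonempty. *)
Definition mcx x k l : {pred chain} := fun c => all (mcx_gen x k l) (msupp c).

Lemma mcx_zmod_closed x k l : zmod_closed (mcx x k l).
Proof.
split=> [|c1 c2 /allP h1 /allP h2]; first by rewrite unfold_in msupp0.
apply/allP => s /(fsubsetP (msuppB_le _ _)).
by rewrite in_fsetU => /orP[/h1|/h2].
Qed.
HB.instance Definition _ x k l := GRing.isZmodClosed.Build chain (mcx x k l)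
  (mcx_zmod_closed x k l).

Definition mcx_ker x k l : {pred chain} :=
  fun c => (c \in mcx x k l) && (bnd c == 0).

Lemma mcx_ker_zmod_closed x k l : zmod_closed (mcx_ker x k l).
Proof.
split=> [|c1 c2 /andP[h1 /eqP z1] /andP[h2 /eqP z2]].
  by apply/andP; rewrite rpred0 raddf0.
by apply/andP; rewrite rpredB // raddfB /= z1 z2 subrr.
Qed.
HB.instance Definition _ x k l := GRing.isZmodClosed.Build chain
  (mcx_ker x k l) (mcx_ker_zmod_closed x k l).

Record cycles x k l := Cycle
  { cycle_val :> chain; cycle_mem : cycle_val \in mcx_ker x k l }.
HB.instance Definition _ x k l := [isSub for @cycle_val x k l].
HB.instance Definition _ x k l := [Choice of cycles x k l by <:].
HB.instance Definition _ x k l :=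
  [SubChoice_isSubZmodule of cycles x k l by <:].

(* Since bnd maps MC^x_{k+1,l} into the cycles of MC^x_{k,l}, this is the whole
   image of MC^x_{k+1,l}. *)
Definition boundaries x k l : {pred cycles x k l} :=
  fun z => `[< exists2 c, c \in mcx x (k + 1) l & bnd c = cycle_val z >].

Lemma boundaries_zmod_closed x k l : zmod_closed (@boundaries x k l).
Proof.
split=> [|z1 z2 /asboolP[c1 h1 e1] /asboolP[c2 h2 e2]]; apply/asboolP.
  by exists 0; rewrite ?rpred0 // raddf0.
by exists (c1 - c2); rewrite ?rpredB // raddfB /= e1 e2.
Qed.
HB.instance Definition _ x k l := GRing.isZmodClosed.Build (cycles x k l)
  (@boundaries x k l) (@boundaries_zmod_closed x k l).

(* MH^x_{k,l} *)
Definition mhx x k l : zmodType := Quotient.quot (@boundaries x k l).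

End Graph.

Definition zmod_isom (A B : zmodType) : Prop :=
  exists f : {additive A -> B}, bijective f.

(* Main.v *)
(* Localized complexes split off an explicit contractible part. Below the girth
   bound, an edge uv through x separates the nearby vertices: each z is closer
   to exactly one of u, v, and a geodesic from the farther endpoint to z must
   use the edge. Given a tuple (x, x_1, ...), let a be the first step of the
   geodesic from x to x_1 and compare the tuple with x, a, x, a, .... At the
   first discrepancy, with u the last common term, v the next alternating term
   and z the actual one, either v lies between u and z and can be inserted, or u
   lies between v and z and can be deleted. Signed insertion h satisfies
   hd + dh = id on tuples that are not alternating and vanishes on alternating
   ones, as long as the excess l - k is at most i. Alternating tuples have
   k = l and there is one for each neighbour a of x. *)
From HB Require Import structures.
Require Import Defs.
From mathcomp Require Import all_boot all_order all_algebra.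
From mathcomp Require Import generic_quotient ring_quotient finmap monalg boolp.
From mathcomp Require Import zify.

Set Implicit Arguments.
Unset Strict Implicit.
Unset Printing Implicit Defensive.

Import GRing.Theory.
Local Open Scope ring_scope.
Local Open Scope quotient_scope.

(** * Infima in the extended natural numbers *)

Lemma inf_natP (P : pred nat) n :
  inf_nat P = Some n -> P n /\ forall m, P m -> (n <= m)%N.
Proof. by rewrite /inf_nat; case: pselect => // h [<-]; case: ex_minnP. Qed.

Lemma inf_nat_le (P : pred nat) m :
  P m -> exists2 n, inf_nat P = Some n & (n <= m)%N.
Proof.
move=> Pm; rewrite /inf_nat; case: pselect => [h|]; last by case; exists m.
by exists (ex_minn h) => //; case: ex_minnP => n _; apply.
Qed.

(** * Distances, walks and short cycles through an edge *)

Section Distance.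
Context (V : finType) (e : rel V) (e_sym : symmetric e) (e_irr : irreflexive e).
Implicit Types (x y z : V) (p q s : seq V).

Lemma dist_geodesic x y d : dist e x y = Some d ->
  exists p, [/\ path e x p, last x p = y & size p = d].
Proof.
case/inf_natP=> /existsP[p /andP[px /eqP py]] _.
by exists p; rewrite size_tuple.
Qed.

Lemma dist_le_walk x p : path e x p ->
  exists2 d, dist e x (last x p) = Some d & (d <= size p)%N.
Proof.
by move=> px; apply: inf_nat_le; apply/existsP; exists (in_tuple p); rewrite px /=.
Qed.

Lemma dist_min x p d :
  path e x p -> dist e x (last x p) = Some d -> (d <= size p)%N.
Proof. by move=> /dist_le_walk[d' -> ?] [<-]. Qed.

Lemma distxx x : dist e x x = Some 0%N.
Proof. by have [[] //=] := @dist_le_walk x [::] isT. Qed.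

Lemma dist_eq0 x y : dist e x y = Some 0%N -> x = y.
Proof. by move=> /dist_geodesic[[|? ?] [_ /= + //]]. Qed.

Lemma dist_triangle x y z a b : dist e x y = Some a -> dist e y z = Some b ->
  exists2 c, dist e x z = Some c & (c <= a + b)%N.
Proof.
move=> /dist_geodesic[p [px py <-]] /dist_geodesic[q [qy qz <-]].
have := @dist_le_walk x (p ++ q); rewrite cat_path px py qy last_cat py qz.
by rewrite size_cat; apply.
Qed.

Lemma dist_edge x y : e x y -> dist e x y = Some 1%N.
Proof.
move=> exy; have [|[|[|//]] /= dxy //] := @dist_le_walk x [:: y].
  by rewrite /= exy.
by move: exy; rewrite (dist_eq0 dxy) e_irr.
Qed.

(** If [p] met [v], its remainder would be a walk from [v] to [z] shorter than [d']. *)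
Lemma geodesic_avoid u v z p d' : path e u p -> last u p = z ->
  dist e v z = Some d' -> (size p <= d')%N -> v \notin p.
Proof.
move=> up pz vz szp; apply/negP=> vp; case/splitPr: vp up pz szp => p1 p2.
rewrite cat_path last_cat size_cat /= => /and3P[_ _ vp2] pz.
by have := dist_min vp2; rewrite pz => /(_ _ vz); lia.
Qed.

(* Deleting the edge uv from the closed walk leaves a walk from u to v;
   its shortening, closed up by uv, is a cycle. *)
Lemma local_girth_le u v x p q :
    e u v -> x \in [:: u; v] ->
    path e u p -> v \notin p -> path e v q -> u \notin q ->
    last u p = last v q ->
  exists2 g, local_girth e x = Some g & (g <= (size p + size q).+1)%N.
Proof.
move=> euv xuv pu vp qv uq pq.
have nuv : u != v by apply: contraTneq euv => ->; rewrite e_irr.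
pose e' := [rel a b | e a b && ~~ ((a \in [:: u; v]) && (b \in [:: u; v]))].
have e'_sym : symmetric e'.
  by move=> a b /=; rewrite e_sym andbC [in RHS]andbC [X in ~~ X]andbC.
(* A path that never meets [b] cannot use the deleted edge. *)
have sub a b s : {subset [:: u; v] <= [:: a; b]} -> b \notin a :: s ->
    path e a s -> path e' a s.
  move=> ab nbs; apply: (@sub_in_path _ [pred c | c != b]).
    move=> c d cb db ecd /=; rewrite ecd; apply/negP=> /andP[/ab + /ab].
    rewrite !inE (negPf cb) (negPf db) !orbF => /eqP ca /eqP da.
    by move: ecd; rewrite ca da e_irr.
  by apply/allP=> c cs; apply: contraNneq nbs => <-.
have pu' : path e' u p.
  by apply: (sub u v) => //; rewrite inE negb_or eq_sym nuv.
have qv' : path e' v q.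
  apply: (sub v u) => //; last by rewrite inE negb_or nuv.
  by move=> c; rewrite !inE orbC.
have [s] : exists s, [/\ path e' u s, last u s = v & size s = size p + size q]%N.
  exists (p ++ rev (belast v q)); rewrite cat_path pu' pq size_cat size_rev.
  rewrite size_belast last_cat rev_path (eq_path (e' := e')) => [|? ?].
    by rewrite pq qv'; case: (q) => //= ? ?; rewrite rev_cons last_rcons.
  exact: e'_sym.
case=> us; case/shortenP: us => s' us' uniqs' subs' sv szs.
have szs' : (size s' <= size p + size q)%N.
  by rewrite -szs uniq_leq_size //; case/andP: uniqs'.
have cyc : [&& cycle e (u :: s'), uniq (u :: s') & x \in u :: s'].
  rewrite uniqs' /= rcons_path sv e_sym euv andbT; apply/andP; split.
    by apply: sub_path us' => a b /andP[].
  have vs' : v \in u :: s' by rewrite -sv mem_last.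
  by move: xuv; rewrite !inE => /orP[/eqP->|/eqP->]; rewrite ?eqxx // -in_cons.
(* Length 0 would give u = v, and length 1 would use the deleted edge uv. *)
have sz3 : (2 < (size s').+1)%N.
  case: s' us' sv {uniqs' subs' szs' cyc} => [_ /= uv|a [|//] /=].
    by rewrite uv eqxx in nuv.
  by move=> + av; rewrite av !inE !eqxx orbT /= andbF.
have [|g gE gle] := @inf_nat_le (fun i => (2 < i)%N && [exists c : i.-tuple V,
    [&& cycle e c, uniq c & x \in c]]) (size s').+1.
  by rewrite sz3; apply/existsP; exists (in_tuple (u :: s')).
by exists g => //; apply: leq_trans gle _; rewrite ltnS.
Qed.

(** * Consequences of the girth bound at x *)

Section LargeGirth.
Context (x : V) (i : nat).
Hypothesis girth_ge : leq_enat (2 * i + 5) (local_girth e x).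

Lemma large_cycle u v p q :
    e u v -> x \in [:: u; v] ->
    path e u p -> v \notin p -> path e v q -> u \notin q ->
    last u p = last v q ->
  (2 * i + 4 <= size p + size q)%N.
Proof.
move=> uv xuv up vp vq uq pq; have [g gE gle] := local_girth_le uv xuv up vp vq uq pq.
by move: girth_ge; rewrite gE /=; lia.
Qed.

(** Two geodesics of equal length n avoid the opposite endpoint of uv; with that edge they form a
    closed walk of length 2n + 1, at most 2i + 3. *)
Lemma dist_edge_neq u v z n : e u v -> x \in [:: u; v] -> (n <= i.+1)%N ->
  dist e u z = Some n -> dist e v z = Some n -> False.
Proof.
move=> uv xuv ni uz vz.
have [p [up pz szp]] := dist_geodesic uz; have [q [vq qz szq]] := dist_geodesic vz.
have vp : v \notin p by apply: geodesic_avoid up pz vz _; rewrite ?szp.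
have uq : u \notin q by apply: geodesic_avoid vq qz uz _; rewrite ?szq.
by have := large_cycle uv xuv up vp vq uq; rewrite pz qz szp szq => /(_ erefl); lia.
Qed.

Lemma dist_edge_cases u v z n : e u v -> x \in [:: u; v] -> (n <= i.+1)%N ->
    dist e u z = Some n ->
  dist e v z = Some n.+1 \/ exists2 m, n = m.+1 & dist e v z = Some m.
Proof.
move=> uv xuv ni uz.
have [c vz cle] : exists2 c, dist e v z = Some c & (c <= 1 + n)%N.
  by apply: dist_triangle uz; rewrite dist_edge // e_sym.
have [d + dle] := dist_triangle (dist_edge uv) vz; rewrite uz => -[?]; subst d.
have : c <> n by move=> cn; apply: (dist_edge_neq uv xuv ni uz); rewrite vz cn.
case: (ltngtP c n) => [cn _|cn _|//]; last by left; rewrite vz; congr Some; lia.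
by right; exists c => //; lia.
Qed.

(* A geodesic from u to w through z and one through v would close up to a short
   cycle containing uv. *)
Lemma geodesic_first_step u v z w a b n :
    e u v -> x \in [:: u; v] ->
    dist e u z = Some a.+1 -> dist e v z = Some a.+2 ->
    dist e z w = Some b -> dist e u w = Some (a.+1 + b)%N ->
    dist e v w = Some n -> (a.+1 + b)%N = n.+1 -> (a + b <= i.+1)%N -> False.
Proof.
move=> uv xuv uz vz zw uw vw abn abi.
have [p [up pz szp]] := dist_geodesic uz; have [q [zq qw szq]] := dist_geodesic zw.
have [r [vr rw szr]] := dist_geodesic vw.
have vp : v \notin p by apply: geodesic_avoid up pz vz _; rewrite ?szp.
(* Past [v], the path [q] would reach [w] in fewer than b steps, while d(v, w) = a + b. *)
have vq : v \notin q.
  apply/negP=> /splitPr vq; case: vq zq qw szq => q1 q2.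
  rewrite cat_path last_cat size_cat /= => /and3P[_ _ vq2] qw szq.
  have := dist_min vq2; rewrite qw => /(_ _ vw); lia.
have ur : u \notin r by apply: geodesic_avoid vr rw uw _; rewrite ?szr; lia.
have := @large_cycle u v (p ++ q) r uv xuv; rewrite cat_path up pz zq mem_cat.
rewrite negb_or vp vq last_cat pz qw rw size_cat szp szq szr.
(* The two walks have total length 2(a + b) + 1, at most 2i + 3, one below the bound. *)
by move=> /(_ isT isT vr ur erefl); lia.
Qed.

(** If a and b differed, they would be at distance 2. The edge xa would then be closed up by a
    geodesic from x to z through b and one from a to z. *)
Lemma first_step_uniq a b z n : e x a -> e x b -> dist e x z = Some n.+1 ->
  dist e a z = Some n -> dist e b z = Some n -> (n <= i.+1)%N -> a = b.
Proof.
move=> xa xb xz az bz ni; apply/eqP/negPn/negP=> nab.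
have [ab|[m [<-]]] := @dist_edge_cases x a b 1 xa (mem_head _ _) isT (dist_edge xb).
  exact: (@geodesic_first_step x a b z 0 n n xa (mem_head _ _) (dist_edge xb) ab bz).
by move=> /dist_eq0 ab; rewrite ab eqxx in nab.
Qed.

End LargeGirth.
End Distance.

(** * Linear extension of maps given on generators *)

Section LinearExtension.
Context (K : choiceType).
Implicit Types (f g : K -> {malg int[K]}) (c : {malg int[K]}) (s : K).

(** The boundary [bnd e] unfolds to [lext (bnd_gen e)], so all lemmas below apply to it by
    conversion. *)
Definition lext f c : {malg int[K]} := \sum_(s <- msupp c) c@_s *: f s.

Lemma lext_wide f (d : {fset K}) c :
  (msupp c `<=` d)%fset -> lext f c = \sum_(s <- d) c@_s *: f s.
Proof.
move=> le; rewrite /lext (big_fset_incl _ le) // => s _ /mcoeff_outdom ->.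
by rewrite scale0r.
Qed.

Lemma lext_is_linear f : linear (lext f).
Proof.
move=> a c1 c2; pose d := (msupp c1 `|` msupp c2)%fset.
have le : (msupp (a *: c1 + c2) `<=` d)%fset.
  apply: fsubset_trans (msuppD_le _ _) _; apply: fsetSU; exact: msuppZ_le.
rewrite (lext_wide f le) (@lext_wide f d c1) ?fsubsetUl //.
rewrite (@lext_wide f d c2) ?fsubsetUr // scaler_sumr -big_split /=.
by apply: eq_bigr => s _; rewrite mcoeffD mcoeffZ scalerDl scalerA.
Qed.

HB.instance Definition _ f :=
  GRing.isLinear.Build int {malg int[K]} {malg int[K]} *:%R (lext f)
    (lext_is_linear f).

Lemma lext0 f : lext f 0 = 0. Proof. exact: linear0. Qed.
Lemma lextN f : {morph lext f : c / - c}. Proof. exact: linearN. Qed.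
Lemma lextD f : {morph lext f : c1 c2 / c1 + c2}. Proof. exact: linearD. Qed.
Lemma lextB f : {morph lext f : c1 c2 / c1 - c2}. Proof. exact: linearB. Qed.
Lemma lextZ f a : {morph lext f : c / a *: c}.
Proof. by move=> c; rewrite linearZ. Qed.
Lemma lext_sum f I (d : seq I) (P : pred I) (F : I -> {malg int[K]}) :
  lext f (\sum_(i <- d | P i) F i) = \sum_(i <- d | P i) lext f (F i).
Proof. exact: linear_sum. Qed.

Lemma lextU f s : lext f << s >> = f s.
Proof. by rewrite /lext msuppU oner_eq0 big_seq_fset1 mcoeffUU scale1r. Qed.

Lemma eq_in_lext f g c : {in msupp c, f =1 g} -> lext f c = lext g c.
Proof. by move=> fg; apply: eq_big_seq => s /fg ->. Qed.

Lemma eq_lext f g : f =1 g -> lext f =1 lext g.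
Proof. by move=> fg c; apply: eq_in_lext => s _. Qed.

Lemma lext_id c : lext (fun s => << s >>) c = c.
Proof.
rewrite [RHS]monalgE; apply: eq_bigr => s _.
by apply/malgP=> t; rewrite mcoeffZ !mcoeffU mulr_natr.
Qed.

Lemma lext_comp f g c : lext f (lext g c) = lext (fun s => lext f (g s)) c.
Proof. by rewrite {2}/lext lext_sum; apply: eq_bigr => s _; rewrite lextZ. Qed.

Lemma lext_eq0 f c : {in msupp c, forall s, f s = 0} -> lext f c = 0.
Proof. by move=> f0; rewrite /lext big_seq big1 // => s /f0 ->; rewrite scaler0. Qed.

Lemma lextD_fun f g c : lext (fun s => f s + g s) c = lext f c + lext g c.
Proof. by rewrite /lext -big_split; apply: eq_bigr => s _; rewrite scalerDr. Qed.

Lemma lextN_fun f c : lext (fun s => - f s) c = - lext f c.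
Proof. by rewrite /lext -sumrN; apply: eq_bigr => s _; rewrite scalerN. Qed.

(** This carries conditions on generators, such as degree and length, over to chains. *)
Lemma msupp_lext (P : pred K) f c :
    {in msupp c, forall s, all P (msupp (f s))} -> all P (msupp (lext f c)).
Proof.
move=> fP; rewrite /lext big_seq; apply: (big_ind (fun c => all P (msupp c))).
- by rewrite msupp0.
- move=> c1 c2 /allP h1 /allP h2; apply/allP=> s /(fsubsetP (msuppD_le _ _)).
  by rewrite in_fsetU => /orP[/h1|/h2].
- by move=> s /fP /allP h; apply/allP=> t /(fsubsetP (msuppZ_le _ _)) /h.
Qed.

End LinearExtension.

(** * Recursive forms of the boundary and of the insertion *)

Section Contraction.
Context (V : finType) (e : rel V).
Implicit Types (u v w z : V) (r s : seq V) (c : chain V).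

Definition between u z w := dist e u w == add_enat (dist e u z) (dist e z w).

Definition chain_cons u c : chain V := lext (fun s => << u :: s >>) c.

(* Boundary of (u :: r), with the leading u stripped off. *)
Fixpoint tail_bnd u r : chain V :=
  if r is z :: ((w :: _) as r') then
    - (if between u z w then << r' >> else 0) - chain_cons z (tail_bnd z r')
  else 0.

(* The insertion h, with the leading u stripped off; the signs
   come from the position of the inserted vertex. *)
Fixpoint tail_insert u v r : chain V :=
  if r is z :: r' then
    if z == v then - chain_cons v (tail_insert v u r')
    else if between u v z then - << v :: r >> else 0
  else 0.

(** Here [u] is the vertex preceding [r], and [v] is the one expected next. *)
Fixpoint alternating u v r : bool :=
  if r is z :: r' then (z == v) && alternating v u r' else true.

Lemma chain_cons0 u : chain_cons u 0 = 0. Proof. exact: lext0. Qed.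
Lemma chain_consN u : {morph chain_cons u : c / - c}. Proof. exact: lextN. Qed.
Lemma chain_consD u : {morph chain_cons u : c1 c2 / c1 + c2}.
Proof. exact: lextD. Qed.
Lemma chain_consB u : {morph chain_cons u : c1 c2 / c1 - c2}.
Proof. exact: lextB. Qed.

Lemma chain_consU u s : chain_cons u << s >> = << u :: s >>.
Proof. exact: lextU. Qed.

Lemma lext_chain_cons f u c : lext f (chain_cons u c) = lext (fun s => f (u :: s)) c.
Proof. by rewrite lext_comp; apply: eq_lext => s; rewrite lextU. Qed.

Lemma chain_cons_lext f u c :
  chain_cons u (lext f c) = lext (fun s => chain_cons u (f s)) c.
Proof. exact: lext_comp. Qed.

Lemma tail_bnd_cons2 u z w r : tail_bnd u [:: z, w & r] =
  - (if between u z w then << w :: r >> else 0) -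
    chain_cons z (tail_bnd z (w :: r)).
Proof. by []. Qed.

(** Split off the deletion at index 1; the other indices shift by one, so prefixing a vertex
    reverses their signs. *)
Lemma bnd_gen_cons u r : bnd_gen e (u :: r) = chain_cons u (tail_bnd u r).
Proof.
elim: r u => [|z [|w r] IH] u; rewrite /bnd_gen.
- by rewrite big_geq //= chain_cons0.
- by rewrite big_geq //= chain_cons0.
rewrite [size _]/= [_.-1]/= big_ltn_cond // big_add1.
rewrite tail_bnd_cons2 -IH chain_consB chain_consN /bnd_gen.
rewrite [chain_cons _ (\sum_(_ <= _ < _ | _) _)]lext_sum.
rewrite [(_).-1]/=.
have -> : smooth e 1 [:: u, z, w & r] = between u z w by [].
have -> : \sum_(1 <= k < (size r).+1 | smooth e k.+1 [:: u, z, w & r])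
    (-1) ^+ k.+1 *: << del k.+1 [:: u, z, w & r] >> =
  \sum_(1 <= k < (size r).+1 | smooth e k [:: z, w & r])
    - chain_cons u ((-1) ^+ k *: << del k [:: z, w & r] >>) :> chain V.
  rewrite big_nat_cond [RHS]big_nat_cond; apply: eq_big => [[|k] //|k _].
  by rewrite -/(chain_cons u _) [chain_cons _ _]lextZ lextU -scaleNr exprS mulN1r.
rewrite sumrN; case: between; last by rewrite chain_cons0 oppr0 add0r.
by rewrite chain_consU expr1 scaleN1r.
Qed.

(** Knowing the first vertex of every inserted tuple allows [tail_bnd] to be unfolded on it. *)
Lemma tail_insert_head u v r : exists c, tail_insert u v r = chain_cons v c.
Proof.
case: r => [|z r] /=; first by exists 0; rewrite chain_cons0.
case: eqP => _; first by exists (- tail_insert v u r); rewrite chain_consN.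
case: between; last by exists 0; rewrite chain_cons0.
by exists (- << z :: r >>); rewrite chain_consN chain_consU.
Qed.

End Contraction.

(** * The homotopy identity on tuples of small excess *)

Section LocalContraction.
Context (V : finType) (e : rel V) (e_irr : irreflexive e) (x : V).
Implicit Types (u v w z : V) (r s : seq V) (c : chain V).

(** The degree is [size r], so j bounds length minus degree. An upper bound, unlike an exact value,
    passes to boundary faces and tails with slack. *)
Definition small_excess u r j := path (fun x y => x != y) u r /\
  exists2 n, len e (u :: r) = Some n & (n <= size r + j)%N.

Lemma len_ge_size u r n : path (fun x y => x != y) u r ->
  len e (u :: r) = Some n -> (size r <= n)%N.
Proof.
elim: r u n => [|z r IH] u n //= /andP[uz zr].
have := IH z _ zr; rewrite /len /=.
case duz: dist => [[|d]|] //; first by rewrite (dist_eq0 duz) eqxx in uz.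
by case: foldr => // m /(_ _ erefl) ? [<-]; lia.
Qed.

(** A step of distance a + 1 uses up a units of the excess, and no later step can recover them. *)
Lemma small_excess_cons u z r j : small_excess u (z :: r) j ->
  exists a, [/\ dist e u z = Some a.+1, (a <= j)%N & small_excess z r (j - a)].
Proof.
case=> /= /andP[uz zr] [n].
have := len_ge_size zr; rewrite /small_excess /len /=.
case duz: dist => [[|a]|] //; first by rewrite (dist_eq0 duz) eqxx in uz.
case: foldr => // m /(_ _ erefl) rm [<-] nj; exists a; split=> //; first by lia.
by split=> //; exists m => //; lia.
Qed.

Lemma betweenP u z w a b : dist e u z = Some a -> dist e z w = Some b ->
  reflect (dist e u w = Some (a + b)%N) (between e u z w).
Proof. by move=> uz zw; rewrite /between uz zw /=; apply: eqP. Qed.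

Lemma tail_insert_far u v z r a : e u v -> z != v ->
    dist e u z = Some a -> dist e v z = Some a.+1 -> tail_insert e u v (z :: r) = 0.
Proof.
move=> uv zv uz vz /=; rewrite (negPf zv).
case: (betweenP (dist_edge e_irr uv) vz) => //.
by rewrite uz => -[]; lia.
Qed.

Lemma tail_insert_near u v z r a : e u v -> z != v ->
    dist e u z = Some a.+1 -> dist e v z = Some a ->
  tail_insert e u v (z :: r) = - << v :: z :: r >>.
Proof.
move=> uv zv uz vz /=; rewrite (negPf zv).
by case: (betweenP (dist_edge e_irr uv) vz).
Qed.

Lemma lext_tail_insert_cons u v z c : z != v ->
  lext (tail_insert e u v) (chain_cons z c) =
    if between e u v z then - chain_cons v (chain_cons z c) else 0.
Proof.
move=> zv; rewrite lext_chain_cons /=.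
under eq_lext => s do rewrite (negPf zv).
case: between; last by apply: lext_eq0.
by rewrite lextN_fun [in RHS]/chain_cons lext_chain_cons.
Qed.

(** The girth bound makes this choice unique within distance i + 2 of x. The default is not reached
    when d(x, z) is finite and positive. *)
Definition first_step z : V := odflt z [pick a | e x a && between e x a z].

Lemma first_stepP z n : dist e x z = Some n.+1 ->
  e x (first_step z) /\ dist e (first_step z) z = Some n.
Proof.
move=> xz; have [[|a p] [//=]] := dist_geodesic xz.
move=> /andP[xa ap] pz [szp]; have xa1 := dist_edge e_irr xa.
have [d] := dist_le_walk ap; rewrite pz szp => az dn.
have [d'] := dist_triangle xa1 az; rewrite xz => -[<-] nd.
have dn' : d = n by lia.
rewrite /first_step; case: pickP => [b /= /andP[xb]|/(_ a)]; last first.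
  by rewrite xa /between xa1 az xz dn' /= eqxx.
rewrite /between (dist_edge e_irr xb) xz.
by case bz: dist => [c|] //= /eqP[->].
Qed.

Definition insert_tail r : chain V :=
  if r is z :: _ then tail_insert e x (first_step z) r else 0.

Definition insert s : chain V :=
  if s is y :: r then chain_cons y (insert_tail r) else 0.

(** These are the unpaired tuples, as in discrete Morse theory. The bare tuple (x) has length 0, so
    it is irrelevant for positive l. *)
Definition critical s : bool :=
  if s is [:: _, z & r] then e x z && alternating z x r else false.

Hypothesis e_sym : symmetric e.

Lemma between_back u v : e u v -> between e u v u = false.
Proof.
move=> uv; have vu : e v u by rewrite e_sym.
by rewrite /between distxx !dist_edge.
Qed.

Context (i : nat).
Hypothesis girth_ge : leq_enat (2 * i + 5) (local_girth e x).

(** Faces keeping z admit no insertion of v. Deleting z requires z to lie on a geodesic from u to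
    the next vertex w, and then v cannot lie on such a geodesic. *)
Lemma tail_insert_bnd_far u v z r a : e u v -> x \in [:: u; v] -> z != v ->
    dist e u z = Some a.+1 -> dist e v z = Some a.+2 -> small_excess u (z :: r) i ->
  lext (tail_insert e u v) (tail_bnd e u (z :: r)) = 0.
Proof.
move=> uv xuv zv uz vz /small_excess_cons[a' []].
rewrite uz => -[Ea]; rewrite -{}Ea => ai zr.
have uv1 := dist_edge e_irr uv.
case: r zr => [|w r]; first by rewrite lext0.
case/small_excess_cons=> b [zw bia _].
have nuvz : between e u v z = false.
  by apply/(betweenP uv1 vz); rewrite uz => -[]; lia.
rewrite tail_bnd_cons2 lextB lextN lext_tail_insert_cons // nuvz subr0.
case: (betweenP uz zw) => [uw|_]; last by rewrite lext0 oppr0.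
rewrite lextU /=; case: eqP => [wv|_].
  by move: uw; rewrite wv uv1 => -[]; lia.
rewrite ifF ?oppr0 //; apply/negP => /eqP; rewrite uv1 uw.
case vw: (dist e v w) => [n|] //= -[abn].
(* The excess gives a + b <= i, and d(z, w) is b + 1; hence the bound i + 1. *)
by apply: (geodesic_first_step e_sym e_irr girth_ge uv xuv uz vz zw uw vw); lia.
Qed.

(** Deleting the inserted v gives the tuple back. The other terms cancel because z is removable
    after u exactly when it is removable after v, and then v still lies between u and w. *)
Lemma tail_homotopy_near u v z r a : e u v -> x \in [:: u; v] -> z != v ->
    dist e u z = Some a.+2 -> dist e v z = Some a.+1 -> small_excess u (z :: r) i ->
  lext (tail_insert e u v) (tail_bnd e u (z :: r)) +
    lext (tail_bnd e u) (tail_insert e u v (z :: r)) = << z :: r >>.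
Proof.
move=> uv xuv zv uz vz /small_excess_cons[a' []].
rewrite uz => -[Ea]; rewrite -{}Ea => ai zr.
have uv1 := dist_edge e_irr uv; have vu : e v u by rewrite e_sym.
have uvz : between e u v z by apply/(betweenP uv1 vz).
rewrite (tail_insert_near _ uv zv uz vz) lextN lextU.
rewrite tail_bnd_cons2 uvz opprB opprK addrA.
suff -> : lext (tail_insert e u v) (tail_bnd e u (z :: r)) =
    - chain_cons v (tail_bnd e v (z :: r)) by rewrite addNr add0r.
case: r zr => [|w r]; first by rewrite /= lext0 chain_cons0 oppr0.
case/small_excess_cons=> b [zw bia _].
rewrite !tail_bnd_cons2 lextB lextN lext_tail_insert_cons // uvz.
rewrite chain_consB chain_consN opprB !opprK addrC; congr (_ + _).
have xvu : x \in [:: v; u] by move: xuv; rewrite !inE orbC.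
have wv : dist e v w = Some (a.+1 + b.+1)%N -> (w == v) = false.
  by move=> vw; apply/eqP=> wv; move: vw; rewrite wv distxx => -[].
case: (betweenP vz zw) => [vw|vw]; last first.
  rewrite chain_cons0; case: (betweenP uz zw) => [uw|_]; last by rewrite lext0 oppr0.
  (* If z lies between u and w, the triangle inequality makes it lie between v and w. *)
  case: vw; have [c vw cle] := dist_triangle vz zw.
  by have [d] := dist_triangle uv1 vw; rewrite uw vw => -[<-] ?; congr Some; lia.
have uw : dist e u w = Some (a.+2 + b.+1)%N.
  have abi : (a.+1 + b.+1 <= i.+1)%N by lia.
  (* Otherwise u would start a geodesic from v to w, although one through z leaves v away from u. *)
  have [-> //|[n abn uw]] := dist_edge_cases e_sym e_irr girth_ge vu xvu abi vw.
  have := geodesic_first_step e_sym e_irr girth_ge vu xvu vz uz zw vw uw abn.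
  by case; lia.
rewrite chain_consU; case: (betweenP uz zw) => // _.
rewrite lextU /= wv // /between uw vw uv1 /= eqxx.
by rewrite opprK.
Qed.

(** Induction along the alternating part, exchanging u and v at each step; the first discrepancy
    falls into the far or the near case for the edge vu. *)
Lemma tail_homotopy_adjacent u v r :
    e u v -> x \in [:: u; v] -> small_excess u (v :: r) i ->
  lext (tail_insert e u v) (tail_bnd e u (v :: r)) +
    lext (tail_bnd e u) (tail_insert e u v (v :: r)) =
  if alternating v u r then 0 else << v :: r >>.
Proof.
elim: r u v => [|w r IH] u v uv xuv vr.
  by rewrite /= eqxx lext0 chain_cons0 oppr0 lext0 addr0.
have uv1 := dist_edge e_irr uv; have vu : e v u by rewrite e_sym.
have xvu : x \in [:: v; u] by move: xuv; rewrite !inE orbC.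
have [a []] := small_excess_cons vr; rewrite uv1 => -[Ea] _.
rewrite -{}Ea subn0 => wr; have [c [vw ci _]] := small_excess_cons wr.
have -> : tail_insert e u v [:: v, w & r] =
    - chain_cons v (tail_insert e v u (w :: r)) by rewrite [LHS]/= eqxx.
have -> : lext (tail_bnd e u) (- chain_cons v (tail_insert e v u (w :: r))) =
    chain_cons v (lext (tail_bnd e v) (tail_insert e v u (w :: r))).
  (* Each inner term begins with u, and v cannot be deleted between u and u. *)
  have [d ->] := tail_insert_head e v u (w :: r).
  rewrite lextN !lext_chain_cons chain_cons_lext -lextN_fun; apply: eq_lext => s.
  by rewrite tail_bnd_cons2 (between_back uv) oppr0 sub0r opprK.
rewrite tail_bnd_cons2 lextB lextN.
have -> : lext (tail_insert e u v) (chain_cons v (tail_bnd e v (w :: r))) =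
    - chain_cons v (lext (tail_insert e v u) (tail_bnd e v (w :: r))).
  rewrite lext_chain_cons chain_cons_lext -lextN_fun; apply: eq_lext => s.
  by rewrite /= eqxx.
rewrite opprK -addrA -chain_consD.
have [wu|wu] := eqVneq w u.
  subst w; rewrite IH // (between_back uv) lext0 oppr0 add0r /= eqxx /=.
  by case: alternating; rewrite ?chain_cons0 ?chain_consU.
have -> : alternating v u (w :: r) = false by rewrite /= (negPf wu).
have ci1 : (c.+1 <= i.+1)%N by lia.
have [uw|[m cm uw]] := dist_edge_cases e_sym e_irr girth_ge vu xvu ci1 vw.
(* Here v lies between u and w: the terms behind v vanish, and reinserting the deleted v gives the
   tuple. *)
- rewrite (tail_insert_far _ vu wu vw uw) lext0 addr0.
  rewrite (tail_insert_bnd_far vu xvu wu vw uw wr) chain_cons0 addr0.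
  have -> : between e u v w by apply/(betweenP uv1 vw).
  have wv : w != v by apply: contra_eq_neq vw => ->; rewrite distxx.
  by rewrite lextU (tail_insert_near _ uv wv uw vw) opprK.
(* Here u is nearer to w than v is, so v is not removable and only the terms behind it
   contribute. *)
case: m cm uw => [_ /dist_eq0 uw|m [cm] uw]; first by rewrite uw eqxx in wu.
rewrite cm in vw; rewrite (tail_homotopy_near vu xvu wu vw uw wr) chain_consU.
case: (betweenP uv1 vw) => [|_]; last by rewrite lext0 oppr0 add0r.
by rewrite uw => -[]; lia.
Qed.

Lemma first_step_eq a z n : e x a -> dist e x z = Some n.+1 ->
  dist e a z = Some n -> (n <= i.+1)%N -> first_step z = a.
Proof.
move=> xa xz az ni; have [xb bz] := first_stepP xz.
exact: (first_step_uniq e_sym e_irr girth_ge xb xa xz bz az ni).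
Qed.

(** The tail identities apply once all faces are compared with the same vertex a. *)
Lemma insert_homotopy z r : small_excess x (z :: r) i ->
  lext insert (bnd_gen e [:: x, z & r]) + bnd e (insert [:: x, z & r]) =
    if critical [:: x, z & r] then 0 else << [:: x, z & r] >>.
Proof.
move=> xzr; rewrite bnd_gen_cons [insert [:: _, _ & _]]/=.
have [n [xz ni zr]] := small_excess_cons xzr; have [xa az] := first_stepP xz.
have a1 := dist_edge e_irr xa; set a := first_step z in xa az a1.
have -> : bnd e (chain_cons x (tail_insert e x a (z :: r))) =
    chain_cons x (lext (tail_bnd e x) (tail_insert e x a (z :: r))).
  rewrite [bnd e _]lext_chain_cons chain_cons_lext; apply: eq_lext => s.
  exact: bnd_gen_cons.
have -> : lext insert (chain_cons x (tail_bnd e x (z :: r))) =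
    chain_cons x (lext (tail_insert e x a) (tail_bnd e x (z :: r))).
  rewrite lext_chain_cons [RHS]chain_cons_lext.
  rewrite -[LHS]chain_cons_lext -[RHS]chain_cons_lext; congr chain_cons.
  case: r xzr zr => [|w r] xzr zr; first by rewrite !lext0.
  have [m [zw mi _]] := small_excess_cons zr.
  rewrite tail_bnd_cons2 !lextB !lext_chain_cons; congr (_ - _).
  rewrite !lextN; congr (- _); case: (betweenP xz zw) => [xw|_].
    (* When z is deleted, w decides the first step. Since z lies between x and w, that step is still
       a. *)
    have aw : dist e a w = Some (n + m.+1)%N.
      have [c aw cle] := dist_triangle az zw; have [d] := dist_triangle a1 aw.
      by rewrite xw aw => -[<-] ?; congr Some; lia.
    have bound : (n + m.+1 <= i.+1)%N by lia.
    by rewrite !lextU /insert /insert_tail (first_step_eq xa xw aw bound).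
  by rewrite !lext0.
rewrite -chain_consD [critical _]/=.
have [za|za] := eqVneq z a.
  have xax : x \in [:: x; a] := mem_head _ _.
  rewrite -za in xa xax *; rewrite tail_homotopy_adjacent // xa /=.
  by case: alternating; rewrite ?chain_cons0 ?chain_consU.
(* Now z is at distance at least 2 from x, so the tuple is not critical and a is inserted. *)
have n0 : n != 0%N by apply: contra_neq za => n0; rewrite n0 in az; rewrite (dist_eq0 az).
have nxz : e x z = false.
  by apply: contraNF n0 => /(dist_edge e_irr); rewrite xz => -[->].
case: n n0 xz az {ni zr} => // n _ xz az.
by rewrite nxz (tail_homotopy_near xa (mem_head _ _) za xz az xzr) chain_consU.
Qed.

End LocalContraction.

(** * From the homotopy to cycles and homology *)

Section LocalHomology.
Context (V : finType) (e : rel V) (e_sym : symmetric e) (e_irr : irreflexive e).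
Context (x : V) (i : nat).
Hypothesis girth_ge : leq_enat (2 * i + 5) (local_girth e x).
Implicit Types (u v w z : V) (r s : seq V) (c : chain V) (k : int) (l n : nat).

Lemma add_enatA : associative add_enat.
Proof. by case=> [a|] [b|] [c|] //=; congr Some; lia. Qed.

Lemma len_cons2 u z r : len e [:: u, z & r] = add_enat (dist e u z) (len e (z :: r)).
Proof. by []. Qed.

Lemma msupp_chain_cons (P : pred (seq V)) u c :
  all (fun s => P (u :: s)) (msupp c) -> all P (msupp (chain_cons u c)).
Proof.
move=> /allP cP; apply: msupp_lext => s /cP Ps.
by apply/allP=> t /(fsubsetP msuppU_le); rewrite inE => /eqP ->.
Qed.

(** Inserting a vertex on a geodesic between its neighbours leaves the total length unchanged. *)
Lemma msupp_tail_insert u v r : e u v -> path (fun x y => x != y) u r ->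
  all (fun s => [&& size s == (size r).+1, path (fun x y => x != y) u s
      & len e (u :: s) == len e (u :: r)])
    (msupp (tail_insert e u v r)).
Proof.
elim: r u v => [|z r IH] u v uv; first by rewrite msupp0.
have nuv : u != v by apply: contraTneq uv => ->; rewrite e_irr.
rewrite {1}[path _ _ _]/= [tail_insert _ _ _ _]/= => /andP[uz zr].
have [zv|zv] := eqVneq z v.
  rewrite msuppN; apply: msupp_chain_cons.
  rewrite zv in zr *; have := IH v u; rewrite e_sym => /(_ uv zr).
  apply: sub_all => s /and3P[/eqP sz vs /eqP sE].
  by apply/and3P; split; rewrite ?len_cons2 ?sE //= ?sz ?nuv.
case: ifP => [/eqP uvz|_]; last by rewrite msupp0.
apply/allP=> s; rewrite msuppN => /(fsubsetP msuppU_le); rewrite inE => /eqP ->.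
apply/and3P; split; rewrite ?len_cons2 ?uvz ?add_enatA //=.
by rewrite nuv eq_sym zv zr.
Qed.

Lemma msupp_insert k l s : (0 < l)%N -> mcx_gen e x k l s ->
  all (mcx_gen e x (k + 1) l) (msupp (insert e x s)).
Proof.
case: s => [|y r] //; rewrite /mcx_gen /mc_gen => l0.
case/andP=> /and4P[_ /eqP szk yr /eqP lenr] /eqP[yx]; rewrite yx in yr lenr *.
apply: msupp_chain_cons; case: r szk yr lenr => [|z r] szk xzr lenr.
  (* The one-vertex tuple has length 0. *)
  by move: lenr l0 => -[<-].
have [xa _] : e x (first_step e x z) /\ True.
  case xz : (dist e x z) => [[|n]|].
  - by case/andP: xzr => /eqP[]; apply: dist_eq0 xz.
  - by have [] := first_stepP e_irr xz.
  - by move: lenr; rewrite len_cons2 xz.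
apply: sub_all (msupp_tail_insert xa xzr) => s /and3P[/eqP sz xs /eqP ->].
rewrite lenr /= !eqxx xs !andbT sz -szk /=; apply/eqP; lia.
Qed.

Lemma mcx_gen_small_excess k l s : mcx_gen e x k l s -> (0 < l)%N -> l%:Z <= k + i%:Z ->
  exists z r, s = [:: x, z & r] /\ small_excess e x (z :: r) i.
Proof.
case: s => [|y r] //; rewrite /mcx_gen /mc_gen.
case/andP=> /and4P[_ /eqP szk yr /eqP lenr] /eqP[yx]; rewrite yx in yr lenr *.
case: r szk yr lenr => [|z r] /= szk xzr lenr l0 lk; first by case: lenr l0 => <-.
exists z, r; split=> //; split=> //; exists l => //=; lia.
Qed.

(** On a cycle the term hd vanishes, so dh alone removes the critical part. *)
Lemma cycle_homotopy k l c : (0 < l)%N -> l%:Z <= k + i%:Z ->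
    c \in mcx_ker e x k l ->
  bnd e (lext (insert e x) c) =
    lext (fun s => if critical e x s then 0 else << s >>) c.
Proof.
move=> l0 lk /andP[/allP cgen /eqP c0].
have <- : lext (insert e x) (bnd e c) + bnd e (lext (insert e x) c) =
    bnd e (lext (insert e x) c) by rewrite c0 lext0 add0r.
rewrite (lext_comp (insert e x) (bnd_gen e)) [bnd e _](lext_comp (bnd_gen e)).
rewrite -lextD_fun; apply: eq_in_lext => s /cgen gs.
have [z [r [-> zr]]] := mcx_gen_small_excess gs l0 lk.
exact: (insert_homotopy e_irr e_sym girth_ge zr).
Qed.

Lemma mcx_insert k l c : (0 < l)%N -> c \in mcx e x k l ->
  lext (insert e x) c \in mcx e x (k + 1) l.
Proof. by move=> l0 /allP cgen; apply: msupp_lext => s /cgen /msupp_insert; apply. Qed.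

(** * Alternating tuples *)

Fixpoint altseq u v n : seq V := if n is n'.+1 then v :: altseq v u n' else [::].

Lemma size_altseq u v n : size (altseq u v n) = n.
Proof. by elim: n u v => //= n IH u v; rewrite IH. Qed.

Lemma alternatingP u v r : reflect (r = altseq u v (size r)) (alternating u v r).
Proof.
elim: r u v => [|z r IH] u v /=; first by apply: ReflectT.
apply: (iffP andP) => [[/eqP -> /IH <-] //|[-> /IH //]].
Qed.

Lemma len_altseq u v n : e u v -> len e (u :: altseq u v n) = Some n.
Proof.
elim: n u v => [|n IH] u v uv //; have vu : e v u by rewrite e_sym.
by rewrite -[altseq u v n.+1]/(v :: altseq v u n) len_cons2 IH ?(dist_edge e_irr uv).
Qed.

Lemma path_altseq u v n : e u v -> path (fun x y => x != y) u (altseq u v n).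
Proof.
elim: n u v => [|n IH] u v uv //=; rewrite IH ?andbT; last by rewrite e_sym.
by apply: contraTneq uv => ->; rewrite e_irr.
Qed.

(** Each interior vertex has equal neighbours on both sides, so none is removable. *)
Lemma tail_bnd_altseq u v n : e u v -> tail_bnd e u (altseq u v n) = 0.
Proof.
elim: n u v => [|[|n] IH] u v uv //; have vu : e v u by rewrite e_sym.
rewrite [altseq _ _ _]/= tail_bnd_cons2 (between_back e_irr e_sym uv).
by rewrite -[_ :: altseq _ _ _]/(altseq v u n.+1) IH // chain_cons0 !oppr0 addr0.
Qed.

Lemma mcx_gen_altseq a l : e x a -> mcx_gen e x l%:Z l (x :: altseq x a l).
Proof.
move=> xa; rewrite /mcx_gen /mc_gen len_altseq // !eqxx /= size_altseq.
by rewrite path_altseq // !andbT; apply/eqP; lia.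
Qed.

(** All steps have distance 1, so degree and length agree. *)
Lemma critical_altseq k l s : mcx_gen e x k l s -> critical e x s ->
  k = l%:Z /\ exists2 a, e x a & s = x :: altseq x a l.
Proof.
case: s => [|y [|z r]] //; rewrite /mcx_gen /mc_gen.
case/andP=> /and4P[_ /eqP szk _ /eqP lenr] /eqP[yx].
rewrite yx in lenr *; case/andP=> xz /alternatingP rE.
have rE' : z :: r = altseq x z (size r).+1 by rewrite {1}rE.
have := len_altseq (size r).+1 xz; rewrite -rE' lenr => -[lE].
split; last by exists z => //; rewrite rE' lE.
by move: szk => /=; rewrite lE; lia.
Qed.

(** Every step has length at least 1, so the degree of a generator is at most its length. *)
Lemma mcx_gt_eq0 k l c : (l%:Z < k) -> c \in mcx e x k l -> c = 0.
Proof.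
move=> lk /allP cgen; rewrite [c]monalgE big_seq big1 // => s /cgen.
case: s => [|y r] //; case/andP=> /and4P[_ /eqP /= szk yr /eqP lenr] _.
by have := len_ge_size yr lenr; lia.
Qed.

(** * Homology below and in the top degree *)

Lemma boundariesP k l (z : cycles e x k l) :
  reflect (exists2 c, c \in mcx e x (k + 1) l & bnd e c = cycle_val z)
    (z \in @boundaries V e x k l).
Proof. exact: asboolP. Qed.

Lemma pi_boundary k l (z z' : cycles e x k l) :
  \pi_(mhx e x k l) z = \pi_(mhx e x k l) z' -> z - z' \in @boundaries V e x k l.
Proof. by move=> /eqP; rewrite -Quotient.idealrBE. Qed.

(** Critical tuples occur only in degree l, so for positive j each cycle is the boundary of its
    insertion. *)
Lemma mhx_eq0 l j (q : mhx e x (l%:Z - j%:Z) l) :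
  (0 < l)%N -> (0 < j <= i)%N -> q = 0.
Proof.
move=> l0 /andP[j0 ji]; rewrite -[q]reprK; set z := repr q.
rewrite -[RHS](raddf0 \pi_(mhx e x (l%:Z - j%:Z) l)).
apply/eqP; rewrite -Quotient.idealrBE subr0; apply/boundariesP.
have /andP[zgen _] := cycle_mem z.
exists (lext (insert e x) (cycle_val z)); first exact: mcx_insert.
rewrite (cycle_homotopy l0 _ (cycle_mem z)); last by lia.
rewrite -[RHS]lext_id; apply: eq_in_lext => s sz.
by case: ifP => // /(critical_altseq (allP zgen _ sz))[]; lia.
Qed.

(** The insertion of c lies in degree l + 1, where all chains vanish; hence the noncritical part of
    c is zero. *)
Lemma top_cycle_critical l c s : (0 < l)%N -> c \in mcx_ker e x l%:Z l ->
  s \in msupp c -> exists2 a, e x a & s = x :: altseq x a l.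
Proof.
move=> l0 cker sc; have /andP[cgen _] := cker.
have cE : lext (fun s => if critical e x s then 0 else << s >>) c = 0.
  rewrite -(cycle_homotopy l0 _ cker); last by lia.
  rewrite (mcx_gt_eq0 _ (mcx_insert l0 cgen)) ?raddf0 //; lia.
have crit : all (critical e x) (msupp c).
  (* Subtracting the vanishing noncritical part writes c through critical generators. *)
  rewrite -[c]lext_id -[X in msupp X]subr0 -cE -lextN_fun -lextD_fun.
  apply: msupp_lext => t _; case: ifP => ct; last by rewrite subrr msupp0.
  by rewrite subr0; apply/allP=> t' /(fsubsetP msuppU_le); rewrite inE => /eqP ->.
by have [_] := critical_altseq (allP cgen _ sc) (allP crit _ sc).
Qed.

(** Boundaries in degree l come from degree l + 1, where there are no nonzero chains. *)
Lemma pi_top_inj l (z z' : cycles e x l%:Z l) :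
  \pi_(mhx e x l%:Z l) z = \pi_(mhx e x l%:Z l) z' -> z = z'.
Proof.
move=> /pi_boundary /boundariesP[c cgen cE]; apply/eqP; rewrite -subr_eq0.
apply/eqP/val_inj; apply: etrans (esym cE) _.
by rewrite (mcx_gt_eq0 _ cgen) ?raddf0 //; lia.
Qed.

(** Numbering the neighbours of x by [enum_val] matches them with row coordinates. *)
Definition alt_gen l (a : 'I_(deg e x)) : seq V := x :: altseq x (enum_val a) l.

Lemma edge_enum_val (a : 'I_(deg e x)) : e x (enum_val a).
Proof. by have := enum_valP a; rewrite inE. Qed.

Lemma alt_gen_inj l : (0 < l)%N -> injective (alt_gen l).
Proof. by case: l => // l _ a b [] /enum_val_inj. Qed.

Definition alt_chain l (r : 'rV[int]_(deg e x)) : chain V :=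
  \sum_a r 0 a *: << alt_gen l a >>.

Lemma mcoeff_alt_chain l (r : 'rV[int]_(deg e x)) a :
  (0 < l)%N -> (alt_chain l r)@_(alt_gen l a) = r 0 a.
Proof.
move=> l0; rewrite raddf_sum (bigD1 a) //= mcoeffZ mcoeffUU mulr1 big1 ?addr0 //.
move=> b ba; rewrite mcoeffZ mcoeffU (inj_eq (alt_gen_inj l0)) (negPf ba).
by rewrite mulr0n mulr0.
Qed.

Lemma alt_chain_ker l (r : 'rV[int]_(deg e x)) : alt_chain l r \in mcx_ker e x l%:Z l.
Proof.
apply: rpred_sum => a _; apply/andP; split.
  apply/allP=> s /(fsubsetP (msuppZ_le _ _)) /(fsubsetP msuppU_le).
  by rewrite inE => /eqP ->; apply: mcx_gen_altseq; apply: edge_enum_val.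
have -> : bnd e (r 0 a *: << alt_gen l a >>) = r 0 a *: bnd_gen e (alt_gen l a).
  by rewrite [LHS]lextZ lextU.
by rewrite bnd_gen_cons tail_bnd_altseq ?edge_enum_val // chain_cons0 scaler0.
Qed.

(** Reading coordinates off the representative is harmless, since each class contains exactly one
    cycle. *)
Definition top_coord l (q : mhx e x l%:Z l) : 'rV[int]_(deg e x) :=
  \row_a (cycle_val (repr q))@_(alt_gen l a).

Lemma repr_pi_top l (z : cycles e x l%:Z l) : repr (\pi_(mhx e x l%:Z l) z) = z.
Proof. by apply: pi_top_inj; rewrite reprK. Qed.

Lemma top_coord_is_zmod_morphism l : zmod_morphism (@top_coord l).
Proof.
move=> q1 q2; rewrite -[q1]reprK -[q2]reprK -(raddfB \pi_(mhx e x l%:Z l)).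
by apply/rowP=> a; rewrite !mxE !repr_pi_top /= mcoeffB.
Qed.

HB.instance Definition _ l := GRing.isZmodMorphism.Build (mhx e x l%:Z l)
  'rV[int]_(deg e x) (@top_coord l) (@top_coord_is_zmod_morphism l).

Lemma mhx_top_isom l :
  (0 < l)%N -> zmod_isom (mhx e x l%:Z l) 'rV[int]_(deg e x).
Proof.
move=> l0; exists (@top_coord l).
exists (fun r : 'rV[int]_(deg e x) =>
  \pi_(mhx e x l%:Z l) (Cycle (alt_chain_ker l r))) => [q|r].
  rewrite -[RHS]reprK; congr (\pi_(mhx e x l%:Z l) _); apply: val_inj => /=.
  apply/malgP=> s.
  (* Off the alternating tuples both chains have coefficient zero. *)
  have [[a ->]|sa] := pselect (exists a, s = alt_gen l a).
    by rewrite mcoeff_alt_chain // mxE.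
  rewrite [RHS]mcoeff_outdom.
    rewrite raddf_sum big1 // => a _ /=; rewrite mcoeffZ mcoeffU.
    by case: eqP => [as_|_]; rewrite ?mulr0 //; case: sa; exists a.
  apply/negP=> /(top_cycle_critical l0 (cycle_mem (repr q)))[a xa sE].
  have ain : a \in [set y | e x y] by rewrite inE.
  by apply: sa; exists (enum_rank_in ain a); rewrite /alt_gen enum_rankK_in.
by apply/rowP=> a; rewrite mxE repr_pi_top /= mcoeff_alt_chain.
Qed.

End LocalHomology.

(** * The computation of localized magnitude homology *)

Theorem theorem1p3 (V : finType) (e : rel V)
    (e_sym : symmetric e) (e_irr : irreflexive e)
    (x : V) (l i : nat) (l_ge1 : (1 <= l)%N)
    (girth_ge : leq_enat (2 * i + 5) (local_girth e x)) :
  zmod_isom (mhx e x l%:Z l) 'rV[int]_(deg e x) /\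
  (forall j : nat, (1 <= j <= i)%N ->
     zmod_isom (mhx e x (l%:Z - j%:Z) l) 'rV[int]_0).
Proof.
split=> [|j j_bounds].
  exact: (mhx_top_isom e_sym e_irr girth_ge l_ge1).
(* Rows of width 0 form the zero group. *)
exists (\0 : {additive mhx e x (l%:Z - j%:Z) l -> 'rV[int]_0}).
exists (fun=> 0) => [q|r]; last by rewrite [r]thinmx0.
by rewrite (mhx_eq0 e_sym e_irr girth_ge q l_ge1 j_bounds).
Qed.
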